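(* Let $r\ge 1$ be an integer, let $\mathcal{M}_1,\ldots,\mathcal{M}_r$ be matroids on the same finite ground set $V$, and let $k$ be a real number. Let $d=r\lceil k\rceil-r+1$. Let $f_1,\ldots,f_d$ be non-negative real-valued functions on $V$ belonging to $\bigcap_{i\le r}P(\mathcal{M}_i)$ and satisfying $|f_j|\ge k$ for every $j\le d$. Let $F_j=\operatorname{supp}(f_j)$ for $j\le d$. Then there exists a function $f\in\bigcap_{i\le r}P(\mathcal{M}_i)$ such that $\operatorname{supp}(f)$ is a rainbow set of $(F_1,\ldots,F_d)$ and $|f|\ge k$.
   Context: For a function $f$ on $V$ and $A\subseteq V$, $f[A]=\sum_{a\in A}f(a)$, $|f|=f[V]$, and $\operatorname{supp}(f)=\{v\in V: f(v)\neq 0\}$. $\mathbb{R}_+$ denotes the non-negative reals. For a matroid $\mathcal{M}$ on $V$ with rank function $\operatorname{rk}_{\mathcal{M}}$, the matroid polytope is $$P(\mathcal{M})=\{f\in\mathbb{R}_+^V : f[A]\le \operatorname{rk}_{\mathcal{M}}(A)\ \text{for every } A\subseteq V\}.$$ For a family (multiset) of sets $(F_1,\ldots,F_m)$, a (partial) rainbow set is the image of a partial choice function, i.e. a set $R=\{x_{i_1},\ldots,x_{i_p}\}$ of distinct elements with $1\le i_1<i_2<\cdots<i_p\le m$ and $x_{i_j}\in F_{i_j}$ for every $j\le p$ (the empty set is allowed). If $d\le 0$, the family of functions is empty. *)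

(* Defs.v *)
From mathcomp Require Import all_boot all_order all_algebra.
From mathcomp Require Import reals.

Set Implicit Arguments.
Unset Strict Implicit.
Unset Printing Implicit Defensive.

Import Order.TTheory GRing.Theory Num.Theory.

Local Open Scope ring_scope.

Record matroid (V : finType) := Matroid {
  indep : {set {set V}};
  indep0 : set0 \in indep;
  indep_sub : forall A B : {set V},
    A \subset B -> B \in indep -> A \in indep;
  indep_exchange : forall A B : {set V},
    A \in indep -> B \in indep -> (#|A| < #|B|)%N ->
    exists2 x, x \in B :\: A & x |: A \in indep
}.

Definition rk (V : finType) (M : matroid V) (A : {set V}) : nat :=
  \max_(B in indep M | B \subset A) #|B|.

Section Functions.
Variables (R : realType) (V : finType).
Implicit Types (f : {ffun V -> R}) (A : {set V}).

Definition fsum f A : R := \sum_(a in A) f a.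

Definition weight f : R := fsum f [set: V].

Definition supp f : {set V} := [set v | f v != 0].

Definition matroid_polytope (M : matroid V) f : Prop :=
  (forall v, 0 <= f v) /\ (forall A, fsum f A <= (rk M A)%:R).

End Functions.

(* A partial choice function is [c : 'I_m -> option V], undefined where it
   returns [None]; its values at distinct indices have to be distinct. *)
Definition rainbow (V : finType) (m : nat) (F : 'I_m -> {set V})
    (S : {set V}) : Prop :=
  exists c : 'I_m -> option V,
    [/\ forall i x, c i = Some x -> x \in F i,
        forall i j x, c i = Some x -> c j = Some x -> i = j
      & S = [set x | [exists i, c i == Some x]]].

(* The number of functions: max(d, 0) for d = r * ceil(k) - r + 1, so that the
   family is empty when d <= 0. *)
Definition family_size (R : realType) (r : nat) (k : R) : nat :=
  if (r%:Z * Num.ceil k - r%:Z + 1)%R is Posz d then d else 0.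

(* Main.v *)
Require Import Defs.
From mathcomp Require Import all_boot all_order all_algebra.
From mathcomp Require Import boolp classical_sets reals.
From mathcomp Require Import ring lra zify.

Set Implicit Arguments.
Unset Strict Implicit.
Unset Printing Implicit Defensive.

Import Order.TTheory GRing.Theory Num.Theory.

Local Open Scope ring_scope.

(** Maximise the total weight over the functions of the polytope that have a
rainbow support.  At a maximising extreme point [f] of weight less than [k] the
support is no larger than the number of tight rank constraints; the tight sets
of each matroid form a chain along which the ranks are strictly increasing
integers below [k], so there are at most [r * (ceil k - 1) < d] of them and some
colour [j] is unused.  If [f] is moreover nondegenerate, the direction
[f_j - f], which increases the weight, is a non-negative combination of edge
directions; an improving edge frees a single constraint, hence enlarges the
support by at most one element of [F_j], which contradicts the maximality.

Nondegeneracy, and the chain structure, are obtained by replacing the bound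
[rk A] by [rk A - e * #|A| ^ 2 + eta A] with [e] small and [eta] generic.  The
[f_j] survive in the perturbed polytope after multiplication by [1 - d], with
[d] small, and since the maximum over the original polytope is attained, it is
at least [k]. *)

(** * Total weight as a linear functional *)

Section Weight.
Variables (R : realType) (V : finType).
Implicit Types (f g : {ffun V -> R}) (A : {set V}).

Lemma fsumE f A : fsum f A = \sum_v (v \in A)%:R * f v.
Proof.
rewrite /fsum [LHS]big_mkcond; apply: eq_bigr => v _.
by case: (v \in A); rewrite ?mul1r ?mul0r.
Qed.

Lemma weightE f : weight f = \sum_v f v.
Proof. by rewrite /weight /fsum; apply: eq_bigl => v; rewrite inE. Qed.

Definition scalef s f : {ffun V -> R} := [ffun v => s * f v].

Lemma weightD f g : weight (f + g) = weight f + weight g.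
Proof.
by rewrite !weightE -big_split; apply: eq_bigr => v _; rewrite ffunE.
Qed.

Lemma weightZ s f : weight (scalef s f) = s * weight f.
Proof. by rewrite !weightE mulr_sumr; apply: eq_bigr => v _; rewrite ffunE. Qed.

Lemma weight_ge0 f : (forall v, 0 <= f v) -> 0 <= weight f.
Proof. by move=> f0; rewrite weightE; apply: sumr_ge0. Qed.

End Weight.

Local Notation "s *v f" := (scalef s f) (at level 40).

(** * Linear independence of rows *)

Section Independence.
Variables (F : fieldType) (J V : finType) (c : J -> V -> F) (S : {set J}).

Let C := \matrix_(p < #|S|, q < #|V|) c (enum_val p) (enum_val q).

Let sum_rows (l : J -> F) q :
  \sum_p l (enum_val p) * C p q = \sum_(j in S) l j * c j (enum_val q).
Proof. by rewrite [RHS]big_enum_val; apply: eq_bigr => p _; rewrite mxE. Qed.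

(** Independent rows form a row-free matrix, and the columns of a right inverse are the dual
    vectors. They become the edge directions at a simple point. *)
Lemma dual_basis :
    (forall l : J -> F, (forall v, \sum_(j in S) l j * c j v = 0) ->
       forall j, j \in S -> l j = 0) ->
  forall j0, j0 \in S ->
  exists h : {ffun V -> F}, forall j, j \in S ->
    \sum_v c j v * h v = (j == j0)%:R.
Proof.
move=> indepS j0 Sj0.
have Cfree : row_free C.
  apply: inj_row_free => u uC; apply/rowP => p; rewrite mxE.
  pose l j := u 0 (enum_rank_in Sj0 j).
  rewrite -[p](enum_valK_in Sj0).
  apply: (indepS l) => [v|]; last exact: enum_valP.
  have := sum_rows l (enum_rank v); rewrite enum_rankK => <-.
  transitivity ((u *m C) 0 (enum_rank v)); last by rewrite uC mxE.
  by rewrite mxE; apply: eq_bigr => p' _; rewrite /l enum_valK_in.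
have /row_freeP[X CX] := Cfree.
exists [ffun v => X (enum_rank v) (enum_rank_in Sj0 j0)] => j Sj.
transitivity ((C *m X) (enum_rank_in Sj0 j) (enum_rank_in Sj0 j0)).
  rewrite mxE (reindex_onto (@enum_val V predT) enum_rank) /=; last first.
    by move=> v _; rewrite enum_rankK.
  apply: eq_big => q; first by rewrite enum_valK eqxx.
  by move=> _; rewrite ffunE mxE enum_rankK_in // enum_valK.
rewrite CX mxE; congr (_%:R); congr nat_of_bool.
by apply/eqP/eqP => [/(congr1 enum_val)|->//]; rewrite !enum_rankK_in.
Qed.

(** A trivial common kernel of the rows makes the transpose row free, so its rank [#|V|] is at most
    its number [#|S|] of columns. *)
Lemma card_le_rows :
    (forall g : {ffun V -> F},
       (forall j, j \in S -> \sum_v c j v * g v = 0) -> g = 0) ->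
  (#|V| <= #|S|)%N.
Proof.
move=> indepV.
have : row_free C^T.
  apply: inj_row_free => u uC.
  have /ffunP g0 : [ffun v => u 0 (enum_rank v)] = 0.
    apply: indepV => j Sj.
    transitivity ((u *m C^T) 0 (enum_rank_in Sj j)); last by rewrite uC mxE.
    rewrite mxE (reindex_onto (@enum_val V predT) enum_rank) /=; last first.
      by move=> v _; rewrite enum_rankK.
    apply: eq_big => q; first by rewrite enum_valK eqxx.
    by move=> _; rewrite !(ffunE, mxE) enum_rankK_in // enum_valK mulrC.
  by apply/rowP => q; have := g0 (enum_val q); rewrite !ffunE enum_valK mxE.
by rewrite /row_free => /eqP {1}<-; apply: rank_leq_col.
Qed.

End Independence.

(** * Extreme points and edges of polyhedra *)

Section Polyhedron.
Variables (R : realType) (J V : finType) (c : J -> V -> R) (b : J -> R).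
Implicit Types (f g : {ffun V -> R}) (j : J) (s : R).

Definition lhs f j := \sum_v c j v * f v.
Definition polyhedron f := forall j, lhs f j <= b j.
Definition active f := [set j | lhs f j == b j].
(** Extremality in its rank form rather than through convex combinations, since only the kernel of
    the active rows is ever used. *)
Definition extreme f :=
  forall g, (forall j, j \in active f -> lhs g j = 0) -> g = 0.

Lemma lhsD f g j : lhs (f + g) j = lhs f j + lhs g j.
Proof.
by rewrite /lhs -big_split; apply: eq_bigr => v _; rewrite ffunE mulrDr.
Qed.

Lemma lhsZ s g j : lhs (s *v g) j = s * lhs g j.
Proof.
by rewrite /lhs mulr_sumr; apply: eq_bigr => v _; rewrite ffunE mulrCA.
Qed.

Lemma lhsB f g j : lhs (f - g) j = lhs f j - lhs g j.
Proof.
rewrite /lhs -sumrB; apply: eq_bigr => v _.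
by rewrite !ffunE mulrDr mulrN. Qed.

Lemma lhs_sum (P : pred J) (F : J -> {ffun V -> R}) j :
  lhs (\sum_(i | P i) F i) j = \sum_(i | P i) lhs (F i) j.
Proof.
elim/big_ind2: _ => [|f x g y <- <-|//]; last by rewrite lhsD.
by rewrite /lhs big1 // => v _; rewrite ffunE mulr0.
Qed.

(** The step is the least ratio of slack to growth over the rows that grow along [g]; these are
    inactive, so it is positive, and a minimising row becomes active. If no row grows, any step
    works. *)
Lemma ratio_test f g : polyhedron f ->
    (forall j, j \in active f -> lhs g j <= 0) ->
  exists s, [/\ 0 < s, polyhedron (f + s *v g)
    & (exists j, 0 < lhs g j) ->
      exists j, 0 < lhs g j /\ j \in active (f + s *v g)].
Proof.
move=> Pf fg; have slack_gt0 j : 0 < lhs g j -> 0 < b j - lhs f j.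
  move=> gj; rewrite subr_gt0 lt_neqAle Pf andbT; apply/negP => fj.
  by have := fg j; rewrite inE fj leNgt gj => /(_ isT).
have [[j0 gj0]|nog] := pselect (exists j, 0 < lhs g j); last first.
  exists 1; split => // j; rewrite lhsD lhsZ mul1r -[b j]addr0 lerD //.
  by rewrite leNgt; apply/negP => gj; apply: nog; exists j.
pose q j := (b j - lhs f j) / lhs g j.
case: (@Order.TotalTheory.arg_minP _ _ _ j0 (fun j => 0 < lhs g j) q gj0)
  => j1 gj1 qmin.
have q1 : 0 < q j1 by rewrite divr_gt0 // slack_gt0.
exists (q j1); split => // [j|_]; last first.
  exists j1; split=> //; rewrite inE lhsD lhsZ divfK ?(gt_eqF gj1) //.
  by rewrite addrCA subrr addr0.
rewrite lhsD lhsZ -lerBrDl; have [gj|gj] := ltP 0 (lhs g j).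
  by rewrite -ler_pdivlMr // qmin.
by rewrite (@le_trans _ _ 0) ?subr_ge0 // mulr_ge0_le0 // ltW.
Qed.

Hypothesis bounded : forall g, (forall j, lhs g j <= 0) -> g = 0.

(** A non-extreme point can move along some [g] that keeps its active rows active; up to the sign of
    [g], the weight does not drop. Boundedness makes a further row active, so the number of inactive
    rows decreases. *)
Lemma extreme_above f : polyhedron f ->
  exists f', [/\ polyhedron f', extreme f', active f \subset active f'
    & weight f <= weight f'].
Proof.
have [n] := ubnP #|~: active f|; elim: n f => // n IHn f lefn Pf.
have [|nextr] := pselect (extreme f); first by exists f; split.
have [g [fg g_neq0 g_ge0]] : exists g,
    [/\ forall j, j \in active f -> lhs g j = 0,
    g <> 0 & 0 <= weight g].
  apply: contrapT => nog; apply: nextr => g fg; apply: contrapT => g_neq0.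
  apply: nog; have [g_ge0|g_lt0] := leP 0 (weight g); first by exists g.
  exists (-1 *v g); split=> [j fj||]; first by rewrite lhsZ fg ?mulr0.
    move=> /ffunP g0; apply: g_neq0; apply/ffunP => v; have := g0 v.
    by rewrite !ffunE mulN1r => /eqP; rewrite oppr_eq0 => /eqP.
  by rewrite weightZ mulN1r oppr_ge0 ltW.
have [s [s_gt0 Ps]] : exists s, [/\ 0 < s, polyhedron (f + s *v g)
    & (exists j, 0 < lhs g j) ->
      exists j, 0 < lhs g j /\ j \in active (f + s *v g)].
  by apply: ratio_test => // j /fg->.
case.
  apply: contrapT => nog; apply: g_neq0; apply: bounded => j; rewrite leNgt.
  by apply/negP => gj; apply: nog; exists j.
move=> j1 [gj1 j1act].
have sub : active f \subset active (f + s *v g).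
  apply/fintype.subsetP => j fj; have gj := fg j fj; move: fj.
  by rewrite !inE lhsD lhsZ gj mulr0 addr0.
have [|f' [Pf' ef' sub' le']] := IHn (f + s *v g) _ Ps.
  rewrite -ltnS (leq_trans _ lefn) // ltnS proper_card // properC.
  apply/properP; split=> //; exists j1 => //.
  by apply/negP => /fg gj; rewrite gj ltxx in gj1.
exists f'; split=> //; first exact: fintype.subset_trans sub sub'.
by apply: le_trans le'; rewrite weightD weightZ lerDl mulr_ge0 // ltW.
Qed.

Lemma extreme_inj f g : extreme f -> active f = active g -> f = g.
Proof.
move=> ef fg; apply/subr0_eq/ef => j fj; rewrite lhsB.
have := fj; rewrite fg; move: fj; rewrite !inE => /eqP-> /eqP->.
exact: subrr.
Qed.

(* An extreme point is determined by its set of active constraints, so there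
   are finitely many of them and a maximum exists without compactness. *)
Lemma max_extreme (D : {ffun V -> R} -> Prop) f0 :
    (forall f f', active f \subset active f' -> D f -> D f') ->
    polyhedron f0 -> D f0 ->
  exists f, [/\ polyhedron f, extreme f, D f
    & forall f', polyhedron f' -> D f' -> weight f' <= weight f].
Proof.
move=> Dmono Pf0 Df0.
pose E S f := [/\ polyhedron f, extreme f, D f & active f = S].
(* [e S] is the unique such point with active set [S], and the junk value 0 if there is none; [Q]
   selects the sets for which it is genuine. *)
pose e S := xget 0 [set f | E S f]%classic.
have eE S f : E S f -> e S = f.
  move=> ESf; have [Pe ee De ae] : E S (e S) by apply: (xgetI _ ESf).
  by case: ESf => Pf ef Df af; apply: extreme_inj; rewrite // ae.
pose Q S := `[< E S (e S) >].
have above f : polyhedron f -> D f -> exists2 S, Q S & weight f <= weight (e S).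
  move=> Pf /Dmono Df; have [f' [Pf' ef' sub le']] := extreme_above Pf.
  have Ef' : E (active f') f' by split=> //; apply: Df.
  by exists (active f'); rewrite ?/Q (eE _ _ Ef') //; apply/asboolP.
have [S0 QS0 _] := above _ Pf0 Df0.
case: (@Order.TotalTheory.arg_maxP _ _ _ S0 Q (fun S => weight (e S)) QS0)
  => S QS Smax.
have /asboolP[Pe ee De _] := QS; exists (e S); split=> // f Pf Df.
by have [S' QS' le'] := above f Pf Df; apply: le_trans le' (Smax _ QS').
Qed.

(** Nondegeneracy: at an extreme point the active rows then form a basis of the dual space. *)
Definition simple f := forall l : J -> R,
  (forall v, \sum_(j in active f) l j * c j v = 0) ->
  forall j, j \in active f -> l j = 0.

(* At a simple extreme point the feasible directions are spanned by the edges,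
   each of which leaves exactly one active constraint. *)
Lemma improving_edge f f' :
    polyhedron f -> extreme f -> simple f -> polyhedron f' ->
    weight f < weight f' ->
  exists j0 h s, [/\ j0 \in active f, lhs f' j0 < lhs f j0,
    forall j, j \in active f -> j != j0 -> lhs h j = 0
    & [/\ 0 < s, polyhedron (f + s *v h) & weight f < weight (f + s *v h)]].
Proof.
move=> Pf ef sf Pf' ff'; apply: contrapT => noedge.
(* [h j0] is the edge direction that lowers row [j0] and fixes all other active rows. *)
have /choice[h hE] j0 : exists h : {ffun V -> R}, j0 \in active f ->
    forall j, j \in active f -> lhs h j = - (j == j0)%:R.
  have [j0f|] := boolP (j0 \in active f); last by exists 0.
  have [h hE] := dual_basis sf j0f.
  by exists (-1 *v h) => _ j jf; rewrite lhsZ /lhs hE // mulN1r.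
(* Both sides agree on all active rows, hence are equal by extremality. The coefficients are the
   slacks of [f'], so they are non-negative, and if no edge raised the weight, neither would
   [f']. *)
have f'f : f' - f = \sum_(j in active f) (lhs f j - lhs f' j) *v h j.
  apply/subr0_eq/ef => j jf; rewrite !lhsB lhs_sum (bigD1 j) //=.
  rewrite big1 => [|j' /andP[j'f j'j]]; rewrite lhsZ hE //.
    by rewrite eqxx mulrN1 addr0 opprK addrA subrK subrr.
  by rewrite eq_sym (negPf j'j) oppr0 mulr0.
have : weight (f' - f) <= 0; last first.
  by apply/negP; rewrite -ltNge -(ltrD2r (weight f)) add0r -weightD subrK.
rewrite f'f; elim/big_ind: _ => [|g g' g0 g'0|j jf].
- by rewrite weightE big1 // => v _; rewrite ffunE.
- by rewrite weightD -[0]addr0 lerD.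
have := Pf' j; have := jf; rewrite inE => /eqP fj; rewrite -fj => f'j.
have [f'jE|f'j_neq] := eqVneq (lhs f' j) (lhs f j).
  by rewrite weightZ f'jE subrr mul0r.
rewrite weightZ mulr_ge0_le0 ?subr_ge0 //.
rewrite leNgt; apply/negP => hj.
have hact j' : j' \in active f -> lhs (h j) j' <= 0.
  by move=> j'f; rewrite hE // oppr_le0 ler0n.
have [s [s_gt0 Ps _]] := ratio_test Pf hact.
apply: noedge; exists j, (h j), s; split=> //.
- by rewrite lt_neqAle f'j_neq.
- by move=> j' j'f j'j; rewrite hE // (negPf j'j) oppr0.
by split=> //; rewrite weightD weightZ ltrDl mulr_gt0.
Qed.

End Polyhedron.

(** * Packing programs with rainbow supports *)

(** Rules out finitely many linear coincidences at once: each nonzero form gives a nonzero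
    polynomial in the parameter of a curve, and some small parameter avoids all their roots. *)
Lemma generic_point (R : realFieldType) (I K : finType) (l : K -> I -> R)
    (b : I -> R) (e : R) : 0 < e ->
  exists eta : I -> R, (forall i, 0 <= eta i < e) /\
    forall k, (exists i, l k i != 0) -> \sum_i l k i * (b i + eta i) != 0.
Proof.
move=> e_gt0.
(* The point is searched on the curve [t |-> b + (t, t ^ 2, ...)]. *)
pose p k : {poly R} :=
  (\sum_i l k i * b i)%:P + \poly_(n < #|I|.+1) (if n is n'.+1 then
     oapp (fun i : 'I_#|I| => l k (enum_val i)) 0 (insub n') else 0).
have pE k t : (p k).[t] = \sum_i l k i * (b i + t ^+ (enum_rank i).+1).
  under eq_bigr do rewrite mulrDr.
  rewrite big_split hornerD hornerC; congr (_ + _).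
  rewrite horner_poly big_ord_recl mul0r add0r /=.
  rewrite (reindex_onto (@enum_val I predT) enum_rank) /=; last first.
    by move=> v _; rewrite enum_rankK.
  apply: eq_big => n; first by rewrite enum_valK eqxx.
  move=> _; rewrite enum_valK.
  by case: insubP => [n' _ /val_inj->|] //=; rewrite ltn_ord.
have p_neq0 k : (exists i, l k i != 0) -> p k != 0.
  move=> [i lki]; apply: contraNneq lki => /(congr1 (coefp (enum_rank i).+1)).
  rewrite /= coefD coefC coef_poly coef0 add0r ltnS ltn_ord.
  case: insubP => [n _ /val_inj->|]; last by rewrite ltn_ord.
  by rewrite /= enum_rankK => ->.
pose q := \prod_(k | p k != 0) p k.
have q_neq0 : q != 0 by apply/prodf_neq0.
(* As [x < 1] and [x < e], all positive powers of a [t <= x] stay below [e]. *)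
pose x := Num.min 1 e / 2.
have x_gt0 : 0 < x by rewrite divr_gt0 // lt_min ltr01.
have [t /andP[t_gt0 tx] qt] : exists2 t, 0 < t <= x & ~~ root q t.
  apply: contrapT => noroot.
  (* These are [size q] distinct candidates, one more than the degree of [q], so they cannot all be
     roots. *)
  pose ts := [seq x / n.+1%:R | n <- iota 0 (size q)].
  have : (size ts < size q)%N.
    apply: max_poly_roots => //.
      apply/allP => _ /mapP[n _ ->]; apply: contrapT => /negP nroot.
      apply: noroot; exists (x / n.+1%:R) => //.
      rewrite divr_gt0 //=; apply: ler_piMr; first exact: ltW.
      by rewrite invf_le1 ?ler1n.
    rewrite map_inj_uniq ?iota_uniq // => n n' /(mulfI (lt0r_neq0 x_gt0)).
    by move=> /invr_inj /eqP; rewrite eqr_nat => /eqP[].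
  by rewrite size_map size_iota ltnn.
have [x1 xe] : x < 1 /\ x < e.
  have : Num.min 1 e <= 1 by rewrite ge_min lexx.
  have : Num.min 1 e <= e by rewrite ge_min lexx orbT.
  by rewrite /x => ? ?; split; lra.
exists (fun i => t ^+ (enum_rank i).+1); split=> [i|k /p_neq0 pk].
  rewrite exprn_ge0 ?ltW //= (le_lt_trans _ xe) // (le_trans _ tx) //.
  by rewrite exprS ler_piMr ?exprn_ile1 // ltW // (le_lt_trans tx).
rewrite -pE; apply: contraNneq qt => pt.
by rewrite rootE horner_prod (bigD1 k) //= pt mul0r.
Qed.

(** * Rainbow sets *)

Section Rainbow.
Variables (V : finType) (m : nat) (F : 'I_m -> {set V}).
Implicit Types S : {set V}.

Lemma rainbow0 : rainbow F finset.set0.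
Proof.
exists (fun=> None); split=> //; apply/setP => x; rewrite !inE.
by apply/esym/existsP => -[].
Qed.

Lemma rainbow_sub S S' : S' \subset S -> rainbow F S -> rainbow F S'.
Proof.
move=> /fintype.subsetP sub [c [cF c_inj cS]].
pose c' i := if c i is Some x then if x \in S' then Some x else None else None.
have c'E i x : c' i = Some x -> c i = Some x /\ x \in S'.
  by rewrite /c'; case: (c i) => // y; case: ifP => // yS' [<-].
exists c'; split=> [i x /c'E[/cF]||] //.
  by move=> i j x /c'E[ci _] /c'E[cj _]; apply: c_inj cj.
apply/setP => x; rewrite inE; apply/idP/existsP => [xS'|[i /eqP/c'E[]//]].
have := sub x xS'; rewrite cS inE => /existsP[i /eqP ci].
by exists i; rewrite /c' ci xS'.
Qed.

(** A choice function defined everywhere would inject the [m] colours into [S], so some colour is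
    free. It is chosen before [v], because the element entering a support is known only once the
    colour is fixed. *)
Lemma rainbow_add S : rainbow F S -> (#|S| < m)%N ->
  exists j, forall v, v \in F j -> rainbow F (v |: S).
Proof.
move=> Srb lt_Sm; have [c [cF c_inj cS]] := Srb.
have [j cj] : exists j, c j = None.
  apply: contrapT => allc.
  have /choice[x cx] i : exists x, c i = Some x.
    by case ci: (c i) => [x|]; [exists x|case: allc; exists i].
  have x_inj : injective x.
    by move=> i i' xi; apply: c_inj (cx i) _; rewrite cx xi.
  move: lt_Sm; rewrite ltnNge => /negP; apply.
  rewrite -[m]card_ord -(card_imset _ x_inj); apply/subset_leq_card.
  apply/fintype.subsetP => _ /imsetP[i _ ->]; rewrite cS inE; apply/existsP.
  by exists i; rewrite cx.
exists j => v vF; have [vS|vS] := boolP (v \in S).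
  by rewrite (finset.setUidPr _) // finset.sub1set.
have cv i : c i != Some v.
  by apply: contra vS => ci; rewrite cS inE; apply/existsP; exists i.
exists (fun i => if i == j then Some v else c i); split.
- by move=> i x; case: eqP => [-> [<-]|_ /cF].
- move=> i i' x; case: eqP => [->|_]; case: eqP => [->|_] //.
  + by move=> [<-] /eqP; rewrite (negPf (cv i')).
  + by move=> /[swap] [[<-]] /eqP; rewrite (negPf (cv i)).
  + exact: c_inj.
apply/setP => x; rewrite !inE cS inE; apply/orP/existsP.
  case=> [/eqP->|/existsP[i ci]]; first by exists j; rewrite eqxx.
  by exists i; case: (i =P j) ci => // ->; rewrite cj.
case=> i; case: (i =P j) => [_ /eqP[->]|_ ci]; first by left.
by right; apply/existsP; exists i.
Qed.

End Rainbow.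

(** * Packing polyhedra and their perturbation *)

Section Packing.
Variables (R : realType) (V I : finType) (a : I -> V -> R).
Implicit Types (b : I -> R) (f g : {ffun V -> R}).

(** Sign and packing constraints share the index type [V + I], so that the polyhedron lemmas apply
    and the active [inl] rows are the zeros of [f]. *)
Definition packing_row (j : V + I) v : R :=
  match j with inl u => - (v == u)%:R | inr i => a i v end.

Definition packing_rhs b (j : V + I) : R :=
  match j with inl _ => 0 | inr i => b i end.

Lemma lhs_inl f u : lhs packing_row f (inl u) = - f u.
Proof.
rewrite /lhs (bigD1 u) //= eqxx mulN1r big1 ?addr0 // => v /negPf->.
by rewrite oppr0 mul0r.
Qed.

(** A dependence among active rows, paired with [f], yields the same relation among their right-hand
    sides. If it involves an [inr] row, a generic [eta] violates that relation; the [inl] rows alone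
    are independent. *)
Lemma simple_perturbation b (e : R) : 0 < e ->
  exists eta : I -> R, (forall i, 0 <= eta i < e) /\
    forall f, simple packing_row (packing_rhs (fun i => b i + eta i)) f.
Proof.
move=> e_gt0.
pose dep (S : {set V + I}) (l : V + I -> R) :=
  (forall v, \sum_(j in S) l j * packing_row j v = 0) /\
  exists i, inr i \in S /\ l (inr i) != 0.
(* One dependence per set [S] of rows is fixed beforehand, so that [eta] has to avoid only finitely
   many relations. *)
have /choice[l lP] S : exists l, (exists l', dep S l') -> dep S l.
  have [[l dl]|] := pselect (exists l', dep S l'); by [exists l|exists (fun=> 0)].
have [eta [eta_e etaP]] :=
  generic_point (fun (S : {set V + I}) i =>
    if inr i \in S then l S (inr i) else 0) b e_gt0.
exists eta; split=> // f l' l'f.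
set S := active _ _ f in l'f *.
have l'I i : inr i \in S -> l' (inr i) = 0.
  move=> iS; apply/eqP; apply: contraT => l'i.
  have [lS [i' [i'S li']]] : dep S (l S).
    by apply: lP; exists l'; split=> //; exists i.
  have /etaP/eqP[] : exists i, (if inr i \in S then l S (inr i) else 0) != 0.
    by exists i'; rewrite i'S.
  transitivity (\sum_(j in S) l S j * lhs packing_row f j).
    rewrite [RHS]big_mkcond big_sumType /= [X in X + _]big1 ?add0r => [|v _].
      apply: eq_bigr => k _; case: ifP => [|_]; last by rewrite mul0r.
      by rewrite inE => /eqP->.
    by case: ifP => //; rewrite inE => /eqP->; rewrite mulr0.
  rewrite /lhs; under eq_bigr do rewrite mulr_sumr.
  rewrite exchange_big big1 //= => v _.
  under eq_bigr do rewrite mulrA.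
  by rewrite -mulr_suml lS mul0r.
move=> [v vS|]; last exact: l'I.
have := l'f v; rewrite (bigD1 (inl v)) //= eqxx big1 => [|[u|i] /andP[jS ju] /=].
- by rewrite addr0 mulrN1 => /eqP; rewrite oppr_eq0 => /eqP.
- have /negPf-> : v != u by apply: contraNneq ju => ->.
  by rewrite oppr0 mulr0.
- by rewrite l'I // mul0r.
Qed.

Variable b : I -> R.
Hypotheses (b_ge0 : forall i, 0 <= b i) (a_ge0 : forall i v, 0 <= a i v)
  (a_cover : forall v, exists i, 0 < a i v).

Definition packing f :=
  (forall v, 0 <= f v) /\ (forall i, \sum_v a i v * f v <= b i).

Definition tight f := [set i | \sum_v a i v * f v == b i].

Let row := packing_row.
Let rhs := packing_rhs b.

Lemma packingP f : packing f <-> polyhedron row rhs f.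
Proof.
split=> [[f0 fb] [v|i]|Pf]; first by rewrite lhs_inl oppr_le0.
  exact: fb.
split=> [v|i]; last exact: Pf (inr i).
by have := Pf (inl v); rewrite lhs_inl oppr_le0.
Qed.

Lemma packing_bounded g : (forall j, lhs row g j <= 0) -> g = 0.
Proof.
move=> gle; have g_ge0 v : 0 <= g v.
  by have := gle (inl v); rewrite lhs_inl oppr_le0.
apply/ffunP => v; rewrite ffunE; apply/eqP; rewrite eq_le g_ge0 andbT.
have [i ai] := a_cover v.
rewrite -(pmulr_rle0 _ ai); apply: le_trans (gle (inr i)).
by rewrite /lhs (bigD1 v) //= lerDl sumr_ge0 // => u _; rewrite mulr_ge0.
Qed.

Lemma active_inl f v : (inl v \in active row rhs f) = (v \notin supp f).
Proof. by rewrite !inE lhs_inl oppr_eq0 negbK. Qed.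

Lemma supp_active f f' :
  active row rhs f \subset active row rhs f' -> supp f' \subset supp f.
Proof.
move=> /fintype.subsetP sub; apply/fintype.subsetP => v; apply: contraLR.
by rewrite -!active_inl => /sub.
Qed.

(** At least [#|V|] rows are active; those of sign type number [#|~: supp f|], and the others are
    the tight ones. *)
Lemma card_supp_extreme f : extreme row rhs f -> (#|supp f| <= #|tight f|)%N.
Proof.
move=> ef; have := card_le_rows ef.
rewrite -(cardsC (supp f)) addnC -[X in (_ <= X)%N]sum1_card big_sumType /=.
rewrite [X in (_ <= X + _)%N](_ : _ = #|~: supp f|) ?leq_add2l.
  move=> /leq_trans; apply; rewrite -sum1_card; apply: eq_leq.
  by apply: eq_bigl => i; rewrite !inE.
by rewrite sum1_card; apply: eq_card => v; rewrite inE -active_inl.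
Qed.

(** Closure under subsets lets [D] survive the move to an extreme point, which adds active rows and
    so can only shrink the support. *)
Lemma packing_max (D : {set V} -> Prop) :
    (forall S S' : {set V}, S' \subset S -> D S -> D S') -> D finset.set0 ->
  exists f, [/\ packing f, extreme row rhs f, D (supp f)
    & forall f', packing f' -> D (supp f') -> weight f' <= weight f].
Proof.
move=> Dsub D0.
have [|||f [/packingP Pf ef Df fmax]] :=
    @max_extreme R _ _ row rhs packing_bounded (fun f => D (supp f)) 0.
- by move=> f f' /supp_active /Dsub; apply.
- apply/packingP; split=> [v|i]; first by rewrite ffunE.
  by rewrite big1 // => v _; rewrite ffunE mulr0.
- rewrite [supp _](_ : _ = finset.set0) //; apply/setP => v.
  by rewrite !inE ffunE eqxx.
by exists f; split=> // f' /packingP; apply: fmax.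
Qed.

Lemma packing_rainbow m (fs : 'I_m -> {ffun V -> R}) (K : R) :
    (forall f, simple row rhs f) ->
    (forall j, packing (fs j)) -> (forall j, K <= weight (fs j)) ->
    (forall f, packing f -> rainbow (fun j => supp (fs j)) (supp f) ->
       weight f < K -> (#|tight f| < m)%N) ->
  exists f, [/\ packing f, rainbow (fun j => supp (fs j)) (supp f)
    & K <= weight f].
Proof.
move=> all_simple Pfs fsK few_tight.
have [f [Pf ef Df fmax]] := packing_max
  (@rainbow_sub _ _ (fun j => supp (fs j))) (rainbow0 _).
exists f; split=> //; rewrite leNgt; apply/negP => fK.
have lt_m := leq_ltn_trans (card_supp_extreme ef) (few_tight f Pf Df fK).
have [j addj] := rainbow_add Df lt_m.
(* The function of the free colour outweighs [f], so it serves as the target of an improving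
   edge. *)
have Pj := Pfs j; move/packingP: (Pf) (Pj) => Pf' /packingP Pj'.
have [j0 [h [s [j0f lt_j0 h0 [s_gt0 Ps lt_s]]]]] :=
  improving_edge Pf' ef (all_simple f) Pj' (lt_le_trans fK (fsK j)).
have := fmax _ (proj2 (packingP _) Ps).
rewrite leNgt lt_s => /(_ _)/negP; apply=> //.
(* The edge releases [j0] only, so every zero of [f] other than the one encoded by [j0] remains a
   zero. *)
have suppE v : v \notin supp f -> inl v != j0 -> v \notin supp (f + s *v h).
  move=> vf v_neq; have := h0 (inl v); rewrite active_inl vf lhs_inl.
  move=> /(_ isT v_neq)/eqP; rewrite oppr_eq0 => /eqP hv.
  by move: vf; rewrite !inE !ffunE hv mulr0 addr0.
case: j0 j0f lt_j0 {h0} suppE => [u|i] j0f lt_j0 suppE; last first.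
  apply: rainbow_sub Df; apply/fintype.subsetP => v; apply: contraLR => vf.
  exact: suppE.
(* The released row is strictly smaller at [fs j], i.e. [fs j u > f u >= 0], so the entering element
   [u] has the free colour. *)
have u_j : u \in supp (fs j).
  move: lt_j0; rewrite !lhs_inl ltrN2 inE => lt_u; apply: lt0r_neq0.
  by apply: le_lt_trans lt_u; case: Pf.
apply: rainbow_sub (addj _ u_j); apply/fintype.subsetP => v; apply: contraLR.
rewrite !inE negb_or negbK => /andP[vu vf].
have := suppE v; rewrite !inE !negbK; exact.
Qed.

End Packing.

(** * Matroid polytopes *)

Section MatroidRank.
Variables (V : finType) (M : matroid V).
Implicit Types A B : {set V}.

Lemma card_le_rk A B : B \in indep M -> B \subset A -> (#|B| <= rk M A)%N.
Proof. by move=> iB BA; apply: (bigop.bigmax_sup B); rewrite ?iB. Qed.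

Lemma rk_le_card A : (rk M A <= #|A|)%N.
Proof. by apply/bigmax_leqP => B /andP[_ /subset_leq_card]. Qed.

Lemma rk_mono A B : A \subset B -> (rk M A <= rk M B)%N.
Proof.
move=> AB; apply/bigmax_leqP => C /andP[iC CA].
exact: card_le_rk iC (fintype.subset_trans CA AB).
Qed.

(** Exchange against a maximum independent subset [D] of [A] enlarges [B] until it has the size of
    [D]. *)
Lemma indep_extend A B : B \in indep M -> B \subset A ->
  exists C, [/\ C \in indep M, B \subset C, C \subset A & #|C| = rk M A].
Proof.
move=> iB BA.
have [D /andP[iD DA] Dmax] : {D : {set V} | (D \in indep M) && (D \subset A)
    & rk M A = #|D|}.
  apply: (eq_bigmax_cond (fun B : {set V} => #|B|)).
  by apply/card_gt0P; exists B; rewrite unfold_in iB BA.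
have [n] := ubnP (#|D| - #|B|); elim: n B iB BA => // n IHn B iB BA ltn.
have [BD|DB] := ltnP #|B| #|D|; last first.
  exists B; split=> //; apply/eqP.
  by rewrite eqn_leq card_le_rk // Dmax DB.
have [x /setDP[xD xB] ixB] := indep_exchange iB iD BD.
have xA := fintype.subsetP DA x xD.
have [||C [iC xBC CA Crk]] := IHn _ ixB.
- by rewrite finset.subUset finset.sub1set xA.
- by rewrite cardsU1 xB /=; lia.
exists C; split=> //; apply: fintype.subset_trans xBC; exact: finset.subsetUr.
Qed.

(** A maximum independent subset [C] of the intersection extends to one, [D], of the union. The
    traces of [D] on [A] and [B] are independent, have union [D], and meet in a set containing
    [C]. *)
Lemma rk_submodular A B :
  (rk M (A :&: B)%SET + rk M (A :|: B)%SET <= rk M A + rk M B)%N.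
Proof.
have [C [iC _ CAB Crk]] :=
  indep_extend (indep0 M) (finset.sub0set (A :&: B)%SET).
have [|D [iD CD DAB Drk]] := @indep_extend (A :|: B)%SET C iC.
  apply: fintype.subset_trans CAB _.
  exact: fintype.subset_trans (finset.subsetIl _ _) (finset.subsetUl _ _).
have trace X : (#|D :&: X|%SET <= rk M X)%N.
  apply: card_le_rk; last exact: finset.subsetIr.
  exact: indep_sub (finset.subsetIl _ _) iD.
apply: leq_trans (leq_add (trace A) (trace B)); rewrite -Crk -Drk.
rewrite -(cardsUI (D :&: A)%SET) -finset.setIUr (finset.setIidPl DAB).
rewrite addnC leq_add2l finset.setIACA finset.setIid; apply/subset_leq_card.
by rewrite finset.subsetI CD.
Qed.

End MatroidRank.

(** * The perturbed intersection of matroid polytopes *)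

Section Perturbation.
Variables (R : realType) (V : finType) (r : nat) (M : 'I_r -> matroid V).
Implicit Types (f : {ffun V -> R}) (A B : {set V}) (x : 'I_r * {set V}).

Definition mem_row x v : R := (v \in x.2)%:R.

Lemma mem_row_ge0 x v : 0 <= mem_row x v.
Proof. exact: ler0n. Qed.

Lemma mem_row_cover v : (0 < r)%N -> exists x, 0 < mem_row x v.
Proof.
move=> r_gt0; exists (Ordinal r_gt0, [set v]).
by rewrite /mem_row finset.set11 ltr01.
Qed.

Lemma packing_matroids f : (0 < r)%N ->
  packing mem_row (fun x => (rk (M x.1) x.2)%:R) f <->
  forall i, matroid_polytope (M i) f.
Proof.
move=> r_gt0; split=> [[f0 fb] i|Pf].
  by split=> // A; rewrite fsumE; apply: fb (i, A).
split=> [v|[i A]]; first by have [] := Pf (Ordinal r_gt0).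
by have [_ /(_ A)] := Pf i; rewrite fsumE.
Qed.

Lemma fsum_mono f A B : (forall v, 0 <= f v) -> A \subset B ->
  fsum f A <= fsum f B.
Proof.
move=> f0 AB; rewrite !fsumE; apply: ler_sum => v _; apply: ler_wpM2r => //.
by rewrite ler_nat; case: (boolP (v \in A)) => // /(fintype.subsetP AB)->.
Qed.

Lemma fsum_modular f A B :
  fsum f A + fsum f B = fsum f (A :&: B) + fsum f (A :|: B).
Proof.
rewrite !fsumE -!big_split; apply: eq_bigr => v _ /=.
by rewrite !inE; do 2!case: (v \in _); rewrite /= ?mul0r ?add0r ?addr0.
Qed.

Definition nonloops := [set v | [forall i, (0 < rk (M i) [set v])%N]].

(** Such sets have positive rank in every matroid, which leaves room for the perturbation once
    functions are scaled down. *)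
Definition eligible A := (A \subset nonloops) && (A != finset.set0).

Lemma rk_eligible i A : eligible A -> (0 < rk (M i) A)%N.
Proof.
move=> /andP[AW /set0Pn[v vA]]; have := fintype.subsetP AW v vA.
rewrite inE => /forallP/(_ i)/leq_trans; apply; apply: rk_mono.
by rewrite finset.sub1set.
Qed.

Lemma supp_nonloops f : (forall i, matroid_polytope (M i) f) ->
  supp f \subset nonloops.
Proof.
move=> Pf; apply/fintype.subsetP => v; rewrite !inE => fv; apply/forallP => i.
have [f0 /(_ [set v])] := Pf i; rewrite /fsum big_set1 => fvr.
by rewrite -(ltr_nat R); apply: lt_le_trans fvr; rewrite lt0r fv f0.
Qed.

(* The term [- e * #|A| ^ 2] is strictly submodular, so that the tight sets of
   each matroid form a chain, and decreasing in [A], so that the ranks strictly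
   increase along it; [eta < e] is too small to spoil this.  Sets containing
   loops get a bound that is never tight. *)
Variables (e : R) (eta : 'I_r * {set V} -> R).

Definition unperturbed x : R :=
  if eligible x.2 then (rk (M x.1) x.2)%:R - e * (#|x.2| ^ 2)%:R
  else (#|V|.+1)%:R.

Hypotheses (e_gt0 : 0 < e) (eta_e : forall x, 0 <= eta x < e).

Let b x := unperturbed x + eta x.
Let P := packing mem_row b.

Lemma sqr_card_le A : e * (#|A| ^ 2)%:R <= e * (#|V| ^ 2)%:R.
Proof. by rewrite ler_pM2l // ler_nat leq_exp2r // max_card. Qed.

Lemma fsum_perturbed f i A : P f -> A \subset nonloops ->
  fsum f A < (rk (M i) A)%:R - e * (#|A| ^ 2)%:R + e.
Proof.
move=> [_ fb] AW; have [->|A_neq0] := eqVneq A finset.set0.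
  by rewrite /fsum big_set0 cards0 mulr0 subr0 ltr_wpDl.
have := fb (i, A); rewrite -fsumE /b /unperturbed /eligible AW A_neq0 /=.
by move=> /le_lt_trans; apply; rewrite ltrD2l; case/andP: (eta_e (i, A)).
Qed.

(** For nonempty [A] the penalty is at least [e] and absorbs [eta]. Elements outside [nonloops]
    carry no weight, so each set can be cut down to its part in [nonloops]. *)
Lemma packing_perturbed f : P f -> supp f \subset nonloops ->
  forall i, matroid_polytope (M i) f.
Proof.
move=> Pf fW i; have [f0 _] := Pf; split=> // A.
have -> : fsum f A = fsum f (A :&: nonloops).
  rewrite !fsumE; apply: eq_bigr => v _; rewrite inE.
  have [->|fv] := eqVneq (f v) 0; first by rewrite !mulr0.
  by rewrite (fintype.subsetP fW) ?andbT // inE.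
apply: (@le_trans _ _ (rk (M i) (A :&: nonloops))%:R); last first.
  by rewrite ler_nat rk_mono // finset.subsetIl.
have [->|A_neq0] := eqVneq (A :&: nonloops)%SET finset.set0.
  by rewrite /fsum big_set0.
apply: ltW; apply: lt_le_trans (fsum_perturbed i Pf (finset.subsetIr _ _)) _.
rewrite -addrA gerDl addrC subr_le0 ler_pMr // ler1n expn_gt0.
by rewrite card_gt0 A_neq0.
Qed.

(** The bound [#|V|.+1] of an ineligible set exceeds every rank, so it is never attained. *)
Lemma tight_perturbed f x : P f -> supp f \subset nonloops ->
  x \in tight mem_row b f ->
  eligible x.2 /\ (rk (M x.1) x.2)%:R - e * (#|x.2| ^ 2)%:R <= fsum f x.2.
Proof.
move=> Pf fW; rewrite inE -fsumE /b /unperturbed => /eqP fx.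
have /andP[eta0 _] := eta_e x.
move: fx; case: ifP => [_ ->|nel fx]; first by split; rewrite // lerDl.
have [_ /(_ x.2)] := packing_perturbed Pf fW x.1.
rewrite fx => le_rk; have : (#|V|.+1)%:R <= (rk (M x.1) x.2)%:R :> R.
  by apply: le_trans le_rk; rewrite lerDl.
by rewrite ler_nat ltnNge (leq_trans (rk_le_card _ _)) ?max_card.
Qed.

Lemma tight_rk_inj f i A B : P f -> supp f \subset nonloops ->
  (i, A) \in tight mem_row b f -> (i, B) \in tight mem_row b f ->
  rk (M i) A = rk (M i) B -> A = B.
Proof.
move=> Pf fW /(tight_perturbed Pf fW)/=[/andP[AW _] tA].
move=> /(tight_perturbed Pf fW)/=[/andP[BW _] tB] rAB.
(* Nested case: [fsum f X <= fsum f Y] and equal ranks force [#|Y| ^ 2 < #|X| ^ 2 + 1]. *)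
have nested (X Y : {set V}) : (rk (M i) X)%:R - e * (#|X| ^ 2)%:R <= fsum f X ->
    Y \subset nonloops -> rk (M i) X = rk (M i) Y -> X \subset Y -> X = Y.
  move=> tX YW rXY XY; apply/eqP; rewrite finset.eqEcard XY -ltnS.
  have lt_e : e * (#|Y| ^ 2)%:R < e * ((#|X| ^ 2).+1)%:R.
    have := fsum_mono (proj1 Pf) XY; have := fsum_perturbed i Pf YW.
    by rewrite -rXY -natr1 mulrDr mulr1; lra.
  move: lt_e; rewrite ltr_pM2l // ltr_nat => lt_sq.
  by have := subset_leq_card XY; nia.
have IW : (A :&: B \subset nonloops)%SET.
  exact: fintype.subset_trans (finset.subsetIl _ _) AW.
have UW : (A :|: B \subset nonloops)%SET by rewrite finset.subUset AW.
(* Uncrossing: replacing [A], [B] by their intersection and union raises the sum of squares by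
   [2 * #|A :\: B| * #|B :\: A|]. Here the rise is below 2, so one set contains the other. *)
have lt_e : e * (#|A :&: B| ^ 2 + #|A :|: B| ^ 2)%:R <
    e * (#|A| ^ 2 + #|B| ^ 2 + 2)%:R.
  have := fsum_perturbed i Pf IW; have := fsum_perturbed i Pf UW.
  have := fsum_modular f A B; have := rk_submodular (M i) A B.
  by rewrite -(ler_nat R) !natrD !mulrDr; lra.
move: lt_e; rewrite ltr_pM2l // ltr_nat => lt_sq.
have cA := cardsID B A; have cB := cardsID A B.
have cU := cardsUI A B; rewrite finset.setIC in cB.
have [/eqP|/eqP] : #|A :\: B| = 0%N \/ #|B :\: A| = 0%N by nia.
  by rewrite cards_eq0 finset.setD_eq0; apply: nested.
by rewrite cards_eq0 finset.setD_eq0 => BA; apply/esym/nested.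
Qed.

(** A tight pair is determined by its matroid and its rank. That rank is positive by eligibility and
    at most [weight f + e * #|V| ^ 2], hence one of [1, ..., c]. *)
Lemma card_tight f c : P f -> supp f \subset nonloops ->
    weight f + e * (#|V| ^ 2)%:R < c.+1%:R ->
  (#|tight mem_row b f| <= r * c)%N.
Proof.
move=> Pf fW fc.
have rk_c x : x \in tight mem_row b f -> (0 < rk (M x.1) x.2 < c.+1)%N.
  move=> /(tight_perturbed Pf fW)[/rk_eligible-> tx] /=.
  rewrite -(ltr_nat R); apply: le_lt_trans fc; move: tx; rewrite lerBlDr.
  move=> /le_trans; apply; rewrite lerD ?sqr_card_le //.
  exact: fsum_mono (proj1 Pf) (finset.subsetT _).
pose h x : 'I_r * 'I_c.+1 := (x.1, inord (rk (M x.1) x.2)).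
have h_inj : {in tight mem_row b f &, injective h}.
  move=> [i A] [j B] tA tB [ij]; subst j => /(congr1 val) /=.
  have /= /andP[_ cA] := rk_c _ tA; have /= /andP[_ cB] := rk_c _ tB.
  by rewrite !inordK // => /(tight_rk_inj Pf fW tA tB)->.
rewrite -(card_in_imset h_inj).
rewrite (@leq_trans #|finset.setX [set: 'I_r] [set~ ord0 : 'I_c.+1]|) //.
  apply/subset_leq_card/fintype.subsetP => _ /imsetP[x /rk_c/andP[x0 xc] ->].
  by rewrite !inE /= -val_eqE /= inordK // -lt0n.
by rewrite cardsX cardsT cardsC1 !card_ord.
Qed.

End Perturbation.

(** * The number of colours and the choice of constants *)

Lemma family_sizeE (R : realType) r (k : R) : 0 < k ->
  exists c, k <= c.+1%:R /\ family_size r k = (r * c).+1.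
Proof.
move=> k_gt0; have := ceil_ge k; have : 0 < Num.ceil k by rewrite ceil_gt0.
(* The witness is [c = Num.ceil k - 1], so that [r * c.+1 - r + 1 = r * c + 1]. *)
rewrite /family_size; case: (Num.ceil k) => [[|c]|] // _ kc.
exists c; split=> //.
by rewrite (_ : _ + 1 = Posz (r * c).+1) //; lia.
Qed.

Theorem theorem1p6 (R : realType) (V : finType) (r : nat) (r_ge1 : (1 <= r)%N)
    (M : 'I_r -> matroid V) (k : R)
    (f : 'I_(family_size r k) -> {ffun V -> R})
    (f_polytope : forall j i, matroid_polytope (M i) (f j))
    (f_weight : forall j, k <= weight (f j)) :
  exists g : {ffun V -> R},
    [/\ forall i, matroid_polytope (M i) g,
        rainbow (fun j => supp (f j)) (supp g)
      & k <= weight g].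
Proof.
have cover (v : V) : exists x, 0 < mem_row R x v := mem_row_cover R v r_ge1.
have [g [/(packing_matroids M _ r_ge1) Pg _ Dg gmax]] :=
  packing_max (fun x => ler0n R (rk (M x.1) x.2)) (@mem_row_ge0 R V r) cover
    (@rainbow_sub _ _ (fun j => supp (f j))) (rainbow0 _).
exists g; split=> //; rewrite leNgt; apply/negP => gk.
have g_ge0 : 0 <= weight g.
  by apply: weight_ge0 => v; have [] := Pg (Ordinal r_ge1).
(* The case [k <= 0], where the family may be empty, is settled here: a maximiser has non-negative
   weight. *)
have k_gt0 := le_lt_trans g_ge0 gk.
have [c [kc sizeE]] := family_sizeE r k_gt0.
(* This makes [(1 - d) * k] the midpoint of [weight g] and [k]. *)
pose d := (k - weight g) / (2 * k).
have d_gt0 : 0 < d by rewrite divr_gt0 ?subr_gt0 ?mulr_gt0.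
have d_lt1 : d < 1 by rewrite ltr_pdivrMr ?mulr_gt0 //; lra.
have dk : (1 - d) * k = (k + weight g) / 2 by rewrite /d; field; rewrite gt_eqF.
(* Keeps [e * #|V| ^ 2] below both [d], to fit the scaled functions, and [d * k], to bound the
   number of tight sets. The successor in the denominator covers an empty [V]. *)
pose e := d * Num.min 1 k / (#|V| ^ 2).+1%:R.
have min_gt0 : 0 < Num.min 1 k by rewrite lt_min ltr01.
have dmin_gt0 := mulr_gt0 d_gt0 min_gt0.
have e_gt0 : 0 < e := divr_gt0 dmin_gt0 (ltr0Sn _ _).
have eV : e * (#|V| ^ 2)%:R <= d * Num.min 1 k.
  by rewrite /e mulrAC ler_pdivrMr ?ltr0Sn // ler_pM2l // ler_nat.
have eV_d : e * (#|V| ^ 2)%:R <= d.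
  by apply: le_trans eV _; rewrite ler_piMr ?ge_min ?lexx // ltW.
have eV_dk : e * (#|V| ^ 2)%:R <= d * k.
  by apply: le_trans eV _; rewrite ler_pM2l // ge_min lexx orbT.
have [eta [eta_e all_simple]] :=
  simple_perturbation (mem_row R (r:=r)) (unperturbed M e) e_gt0.
pose fs j := (1 - d) *v f j.
have supp_fs j : supp (fs j) = supp (f j).
  apply/setP => v; rewrite !inE ffunE mulf_eq0 negb_or.
  by rewrite (_ : 1 - d != 0) // subr_eq0 gt_eqF.
have W0 S : rainbow (fun j => supp (fs j)) S -> S \subset nonloops M.
  case=> ch [chF _ ->]; apply/fintype.subsetP => v; rewrite inE.
  move=> /existsP[j /eqP/chF]; rewrite supp_fs.
  exact/fintype.subsetP/supp_nonloops.
have scaled A j : fsum (fs j) A = (1 - d) * fsum (f j) A.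
  by rewrite /fsum mulr_sumr; apply: eq_bigr => v _; rewrite ffunE.
(* For eligible sets the rank is at least 1, so scaling frees at least [d], which pays for the
   penalty. *)
have rk_ge x : (1 - d) * (rk (M x.1) x.2)%:R <= unperturbed M e x + eta x.
  have /andP[eta0 _] := eta_e x; rewrite ler_wpDr // /unperturbed.
  have rk_ge0 : 0 <= (rk (M x.1) x.2)%:R :> R by [].
  case: ifP => [/(rk_eligible x.1)|_].
    rewrite -(ler_nat R) => rk_ge1; have := sqr_card_le e_gt0 x.2.
    have : d <= d * (rk (M x.1) x.2)%:R by rewrite ler_pMr.
    by move: eV_d; rewrite mulrBl mul1r; lra.
  have : (rk (M x.1) x.2)%:R <= (#|V|.+1)%:R :> R.
    by rewrite ler_nat (leq_trans (rk_le_card _ _)) // leqW // max_card.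
  by apply: le_trans; rewrite ler_piMl // gerDl oppr_le0 ltW.
have [||||h [Ph Dh hK]] := @packing_rainbow R V _ (mem_row R (r:=r))
  (fun x => unperturbed M e x + eta x) _ (@mem_row_ge0 R V r) cover
  _ fs ((1 - d) * k) all_simple.
- by move=> x; apply: le_trans (rk_ge x); rewrite mulr_ge0 // subr_ge0 ltW.
- move=> j; split=> [v|x]; last first.
    rewrite -fsumE scaled; apply: le_trans (rk_ge x).
    by rewrite ler_pM2l ?subr_gt0 //; have [_] := f_polytope j x.1.
  have [fj0 _] := f_polytope j (Ordinal r_ge1).
  by rewrite ffunE mulr_ge0 // subr_ge0 ltW.
- by move=> j; rewrite weightZ ler_pM2l ?subr_gt0.
- move=> h Ph Dh hK; rewrite [X in (_ < X)%N]sizeE ltnS.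
  apply: (card_tight e_gt0 eta_e Ph (W0 _ Dh)).
  (* The left side is below [(1 - d) * k + d * k = k]. *)
  by apply: lt_le_trans kc; lra.
(* [h] lies in the original polytopes, is rainbow, and weighs at least the midpoint, which exceeds
   the maximum [weight g]. *)
have := gmax h; rewrite leNgt => /(_ _ _)/negP; apply.
- by apply/(packing_matroids M _ r_ge1)/(packing_perturbed e_gt0 eta_e Ph)/W0.
- case: Dh => ch [chF ch_inj hE]; exists ch; split=> // j x /chF.
  by rewrite supp_fs.
by apply: lt_le_trans hK; rewrite dk; lra.
Qed.
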